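(* Fix $p\in(0,1]$ and $t\in(0,1)$. Let $G_n\sim\mathcal G(n,p)$ and, given $G_n$, let $\mathbf X$ be drawn from the Ising model with coupling matrix $A_n(i,j)=\frac{1}{(n-1)p}G_n(i,j)$ and parameters $(\beta,B)$; denote by $\mathbb P^{\mathrm{er}}_{n,\beta,B}$ the joint law of $(\mathbf X,G_n)$ on $\{-1,1\}^n\times\{0,1\}^{\binom n2}$. Let $\Theta_t=\{(\beta,B)\in(0,\infty)^2: t=\tanh(\beta t+B)\}$ and let $\mathbb Q_n$ be the product measure on $\{-1,1\}^n$ with $\mathbb Q_n(X_i=1)=\frac{1+t}{2}=1-\mathbb Q_n(X_i=-1)$. Then for every $(\beta,B)\in\Theta_t$, the sequence $\mathbb Q_n\times\mathcal G(n,p)$ is contiguous with respect to $\mathbb P^{\mathrm{er}}_{n,\beta,B}$: for any events $E_n$, $\mathbb P^{\mathrm{er}}_{n,\beta,B}(E_n)\to0$ implies $(\mathbb Q_n\times\mathcal G(n,p))(E_n)\to0$. Consequently there is no sequence of estimators $(\tilde\beta_n,\tilde B_n)$ (measurable functions of $(\mathbf X,G_n)$) that is consistent for $(\beta,B)$ under $\mathbb P^{\mathrm{er}}_{n,\beta,B}$ for all $(\beta,B)\in\Theta_t$ (and hence none consistent on all of $\Theta=\{\beta>0,B\ne0\}$).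
   Context: $\mathcal G(n,p)$ is the Erdős–Rényi random graph on vertex set $[n]$, each edge present independently with probability $p$; $G_n(i,j)\in\{0,1\}$ is its adjacency indicator ($G_n(i,i)=0$). The Ising model with coupling matrix $A_n$ is $\mathbb P(\mathbf X=\mathbf x)=Z_n^{-1}\exp(\frac{\beta}{2}\mathbf x^\top A_n\mathbf x+B\sum_i x_i)$ on $\{-1,1\}^n$. Note that for $(\beta,B)\in\Theta_t$, $\frac{1+t}{2}=\frac{1}{1+e^{-2(\beta t+B)}}$. An estimator sequence is consistent at $(\beta,B)$ if it converges in $\mathbb P^{\mathrm{er}}_{n,\beta,B}$-probability to $(\beta,B)$. *)

(* Defs.v *)
From mathcomp Require Import all_boot.
From Stdlib Require Import Reals ClassicalEpsilon.
Set Implicit Arguments. Unset Strict Implicit. Unset Printing Implicit Defensive.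

Local Open Scope R_scope.

Definition pair_t (n : nat) := {e : 'I_n * 'I_n | ltn e.1 e.2}.

Definition graph (n : nat) := {ffun pair_t n -> bool}.

Definition config (n : nat) := {ffun 'I_n -> bool}.

Definition spin (b : bool) : R := if b then 1 else -1.

Definition adj (n : nat) (G : graph n) (i j : 'I_n) : R :=
  match boolP (ltn i j), boolP (ltn j i) with
  | AltTrue h, _ => if G (exist _ (i, j) h) then 1 else 0
  | _, AltTrue h => if G (exist _ (j, i) h) then 1 else 0
  | _, _ => 0
  end.

Definition fsum (T : finType) (f : T -> R) : R := \big[Rplus/0]_(x : T) f x.

Definition prob (T : finType) (mass : T -> R) (E : T -> Prop) : R :=
  fsum (fun x => if excluded_middle_informative (E x) then mass x else 0).

Definition er_mass (n : nat) (p : R) (G : graph n) : R :=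
  \big[Rmult/1]_(e : pair_t n) (if G e then p else 1 - p).

Definition coupling (n : nat) (p : R) (G : graph n) (i j : 'I_n) : R :=
  adj G i j / ((INR n - 1) * p).

Definition ising_weight (n : nat) (p beta B : R) (G : graph n) (x : config n) : R :=
  exp (beta / 2 * fsum (fun i : 'I_n => fsum (fun j : 'I_n =>
          spin (x i) * coupling p G i j * spin (x j)))
       + B * fsum (fun i : 'I_n => spin (x i))).

Definition ising_Z (n : nat) (p beta B : R) (G : graph n) : R :=
  fsum (fun x : config n => ising_weight p beta B G x).

Definition Per_mass (n : nat) (p beta B : R) (w : config n * graph n) : R :=
  er_mass p w.2 * (ising_weight p beta B w.2 w.1 / ising_Z p beta B w.2).

Definition Q_mass (n : nat) (t : R) (x : config n) : R :=
  \big[Rmult/1]_(i : 'I_n) (if x i then (1 + t) / 2 else (1 - t) / 2).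

Definition QG_mass (n : nat) (p t : R) (w : config n * graph n) : R :=
  Q_mass t w.1 * er_mass p w.2.

Definition Theta_t (t beta B : R) : Prop :=
  0 < beta /\ 0 < B /\ t = tanh (beta * t + B).

(* estimator sequence: measurable (automatic on finite spaces) maps of (X, G_n) *)
Definition estimator := forall n : nat, config n * graph n -> R * R.

Definition consistent_at (p : R) (est : estimator) (beta B : R) : Prop :=
  forall eps : R, 0 < eps ->
    Un_cv (fun n => prob (@Per_mass n p beta B)
             (fun w => eps < Rabs (fst (est n w) - beta) \/
                       eps < Rabs (snd (est n w) - B))) 0.

(* Main.v *)
Require Import Defs.
From mathcomp Require Import all_boot Rstruct.
From Stdlib Require Import Reals ClassicalEpsilon Lra.
From Coquelicot Require Import Coquelicot.
Local Open Scope R_scope.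

(* Since t = tanh (beta t + B), the conditional law of X given G has density
   exp (L_G(X)) / E_Q exp (L_G) with respect to Q, where
   L_G(x) = beta / ((n-1) p) sum_(i<j) G(i,j) (x_i x_j - t^2) - beta t sum_i (x_i - t).
   So contiguity follows from bounds, uniform in n, on the (Q x G(n,p))-means of exp (- L)
   and of exp L: by Markov's inequality the density is then bounded below outside a set of
   small (Q x G(n,p))-probability. Averaging first over the independent edges, the terms linear
   in x_i - t cancel and, with S = sum_i (x_i - t), both means reduce to those of
   exp (-/+ beta S^2 / (2(n-1))) under Q. The minus sign is trivial. For the plus sign, put
   h = beta t + B: the centred spins are sub-Gaussian with variance proxy tanh h / h (Kearns-Saul),
   and B > 0 says exactly that beta * (tanh h / h) < 1.
   A consistent estimator on Theta_t would separate two points of Theta_t under the same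
   measure Q x G(n,p). *)

(** * The Kearns-Saul inequality *)

Lemma cosh_gt0 x : 0 < cosh x.
Proof. rewrite /cosh; have := exp_pos x; have := exp_pos (- x); lra. Qed.

Lemma is_derive_MVT (f f' : R -> R) (a b : R) : a < b ->
  (forall c, a <= c <= b -> is_derive f c (f' c)) ->
  exists c, f b - f a = f' c * (b - a) /\ a < c < b.
Proof. by move=> ab df; apply: MVT_cor2 => // c /df /is_derive_Reals. Qed.

Lemma sinh_ge0 x : 0 <= x -> 0 <= sinh x.
Proof.
move=> [x0|<-]; last by rewrite sinh_0; lra.
have [c [e _]] : exists c, sinh x - sinh 0 = cosh c * (x - 0) /\ 0 < c < x.
  by apply: MVT_cor2 => // c _; exact: derivable_pt_lim_sinh.
rewrite sinh_0 in e; have := Rmult_le_pos _ _ (Rlt_le _ _ (cosh_gt0 c)) (Rlt_le _ _ x0); lra.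
Qed.

Lemma cosh_incr x y : 0 <= x <= y -> cosh x <= cosh y.
Proof.
move=> [x0 [xy|<-]]; last lra.
have [c [e hc]] : exists c, cosh y - cosh x = sinh c * (y - x) /\ x < c < y.
  by apply: MVT_cor2 => // c _; exact: derivable_pt_lim_cosh.
have c0 : 0 <= sinh c by apply: sinh_ge0; lra.
have := Rmult_le_pos _ (y - x) c0; lra.
Qed.

Lemma sinh_le_mul_cosh x : 0 <= x -> sinh x <= x * cosh x.
Proof.
move=> [x0|<-]; last by rewrite sinh_0; lra.
have [c [e hc]] : exists c, sinh x - sinh 0 = cosh c * (x - 0) /\ 0 < c < x.
  by apply: MVT_cor2 => // c _; exact: derivable_pt_lim_sinh.
rewrite sinh_0 in e.
have : cosh c <= cosh x by apply: cosh_incr; lra.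
move=> /(Rmult_le_compat_l x _ _ (Rlt_le _ _ x0)); lra.
Qed.

(** By convexity: the slope [cosh c] of [sinh] on [u, v] is at least [cosh u], hence at least
    sinh(u)/u. *)
Lemma mul_sinh_le u v : 0 <= u <= v -> v * sinh u <= u * sinh v.
Proof.
move=> [u0 [uv|<-]]; last lra.
have [c [e hc]] : exists c, sinh v - sinh u = cosh c * (v - u) /\ u < c < v.
  by apply: MVT_cor2 => // c _; exact: derivable_pt_lim_sinh.
have cc : cosh u <= cosh c by apply: cosh_incr; lra.
have su := sinh_le_mul_cosh u u0.
have h1 : sinh u <= u * cosh c by have := Rmult_le_compat_l _ _ _ u0 cc; lra.
have := Rmult_le_compat_r (v - u) _ _ ltac:(lra) h1.
have -> : sinh v = sinh u + cosh c * (v - u) by lra.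
lra.
Qed.

(** Twice the difference of the two sides is (b - a) sinh(b + a) - (b + a) sinh(b - a), so
    [mul_sinh_le] applies. For positive arguments this is the monotonicity of tanh(x)/x. *)
Lemma mul_sinh_cosh_le a b :
  0 <= a <= b -> a * sinh b * cosh a <= b * sinh a * cosh b.
Proof.
move=> ab; have := mul_sinh_le (b - a) (b + a) ltac:(lra).
rewrite /sinh /cosh (_ : - (b - a) = - b + a); last ring.
rewrite (_ : b - a = b + - a) // Ropp_plus_distr !exp_plus; lra.
Qed.

(* The function u |-> ln (cosh (sqrt u)) is concave; this is its tangent bound at u = h^2. *)
Lemma cosh_le_gauss h w : 0 < h -> 0 <= w ->
  cosh w <= cosh h * exp (tanh h / h / 2 * (w ^ 2 - h ^ 2)).
Proof.
move=> h0 w0; set a := tanh h / h / 2.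
pose f x := cosh x * exp (- a * x ^ 2).
(* Up to a positive factor, [k x] is the derivative of [f]. It equals cosh(x) (tanh(x) - x
   tanh(h)/h), so [f] increases up to [h] and decreases afterwards. *)
pose k x := (h * cosh h * sinh x - x * sinh h * cosh x) / (h * cosh h).
have ch := cosh_gt0 h.
have hch : 0 < / (h * cosh h) by apply: Rinv_0_lt_compat; apply: Rmult_lt_0_compat.
have df x : is_derive f x (k x * exp (- a * x ^ 2)).
  apply/is_derive_Reals; rewrite /f.
  have -> : k x * exp (- a * x ^ 2) = sinh x * exp (- a * x ^ 2) +
      cosh x * (exp (- a * x ^ 2) * (- a * (2 * x))).
    rewrite /k /a /tanh; field; lra.
  apply: derivable_pt_lim_mult; first exact: derivable_pt_lim_cosh.
  apply/is_derive_Reals; auto_derive => //; rewrite [x ^ 2]/=; ring.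
have fmax : f w <= f h.
  case: (Rtotal_order w h) => [wh|[->|hw]]; last 2 first.
  - exact: Rle_refl.
  - have [c [e hc]] := is_derive_MVT f _ h w hw (fun x _ => df x).
    have := mul_sinh_cosh_le h c ltac:(lra) => kc.
    have : 0 <= - k c * exp (- a * c ^ 2) * (w - h).
      apply: Rmult_le_pos; last lra.
      apply: Rmult_le_pos; last exact/Rlt_le/exp_pos.
      by rewrite /k /Rdiv Ropp_mult_distr_l; apply: Rmult_le_pos; lra.
    lra.
  - have [c [e hc]] := is_derive_MVT f _ w h wh (fun x _ => df x).
    have := mul_sinh_cosh_le c h ltac:(lra) => kc.
    have : 0 <= k c * exp (- a * c ^ 2) * (h - w).
      apply: Rmult_le_pos; last lra.
      apply: Rmult_le_pos; last exact/Rlt_le/exp_pos.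
      by apply: Rmult_le_pos; lra.
    lra.
have -> : a * (w ^ 2 - h ^ 2) = - a * h ^ 2 + a * w ^ 2 by ring.
rewrite exp_plus -Rmult_assoc -/(f h).
have := Rmult_le_compat_r (exp (a * w ^ 2)) _ _ (Rlt_le _ _ (exp_pos _)) fmax.
rewrite /f Rmult_assoc -exp_plus.
have -> : - a * w ^ 2 + a * w ^ 2 = 0 by ring.
by rewrite exp_0 Rmult_1_r.
Qed.

(* The Kearns-Saul inequality for a centred variable on {1 - t, - 1 - t}. *)
Lemma two_point_mgf_le h z : 0 < h ->
  (1 + tanh h) / 2 * exp (z * (1 - tanh h)) +
  (1 - tanh h) / 2 * exp (z * (-1 - tanh h))
  <= exp (tanh h / h * z ^ 2 / 2).
Proof.
move=> h0; set t := tanh h.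
have ch := cosh_gt0 h.
(* The spin of mean [tanh h] is a fair sign tilted by exp(h x), whence the ratio of cosh values. In
   the tangent bound at h + z, the linear term t z then cancels the centring. *)
have -> : (1 + t) / 2 * exp (z * (1 - t)) + (1 - t) / 2 * exp (z * (-1 - t)) =
    exp (- (z * t)) * (cosh (h + z) / cosh h).
  have -> : z * (1 - t) = z + - (z * t) by ring.
  have -> : z * (-1 - t) = - z + - (z * t) by ring.
  rewrite !exp_plus {1 3}/t /tanh.
  have -> : cosh (h + z) = cosh h * cosh z + sinh h * sinh z.
    by rewrite /cosh /sinh Ropp_plus_distr !exp_plus; field.
  have -> : exp z = cosh z + sinh z by rewrite /cosh /sinh; field.
  have -> : exp (- z) = cosh z - sinh z by rewrite /cosh /sinh; field.
  field; lra.
have cabs : cosh (h + z) = cosh (Rabs (h + z)).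
  rewrite /Rabs; case: Rcase_abs => // _.
  by rewrite /cosh Ropp_involutive Rplus_comm.
have := cosh_le_gauss h _ h0 (Rabs_pos (h + z)).
rewrite -cabs pow2_abs -/t => le.
have -> : t / h * z ^ 2 / 2 = - (z * t) + t / h / 2 * ((h + z) ^ 2 - h ^ 2).
  by field; lra.
rewrite exp_plus; apply: Rmult_le_compat_l; first exact/Rlt_le/exp_pos.
apply: (Rmult_le_reg_r (cosh h)) => //.
have -> : cosh (h + z) / cosh h * cosh h = cosh (h + z) by field; lra.
lra.
Qed.

(** From exp(-v) >= 1 - v one gets exp(v) (1 - v) <= 1, while (1 - v)(1 + v + 2v^2) = 1 + v^2 (1 -
    2v) >= 1. *)
Lemma exp_le_quadratic v : v <= 1 / 2 -> exp v <= 1 + v + 2 * v ^ 2.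
Proof.
move=> v12; have := exp_ineq1_le (- v) => e1.
have ev : exp v * exp (- v) = 1 by rewrite -exp_plus Rplus_opp_r exp_0.
have : exp v * (1 - v) <= 1.
  by rewrite -ev; apply: Rmult_le_compat_l; [exact/Rlt_le/exp_pos|lra].
have v2 : 0 <= v ^ 2 * (1 - 2 * v) by apply: Rmult_le_pos; [exact: pow2_ge_0|lra].
move=> le1; apply: (Rmult_le_reg_r (1 - v)); lra.
Qed.

Lemma bernoulli_mgf_le p v : 0 <= p -> v <= 1 / 2 ->
  1 - p + p * exp v <= exp (p * v + 2 * p * v ^ 2).
Proof.
move=> p0 /exp_le_quadratic ev; have := Rmult_le_compat_l _ _ _ p0 ev.
have := exp_ineq1_le (p * v + 2 * p * v ^ 2); lra.
Qed.

(** * Finite sums and products *)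

Lemma exp_le x y : x <= y -> exp x <= exp y.
Proof. by move=> [/exp_increasing|->]; [exact: Rlt_le|exact: Rle_refl]. Qed.

Lemma sumR_le (T : finType) (f g : T -> R) :
  (forall x, f x <= g x) -> \big[Rplus/0]_x f x <= \big[Rplus/0]_x g x.
Proof.
move=> fg; elim/big_ind2: _ => [|a b c d|i _]; last exact: fg; first exact: Rle_refl.
exact: Rplus_le_compat.
Qed.

Lemma sumR_ge0 (T : finType) (f : T -> R) :
  (forall x, 0 <= f x) -> 0 <= \big[Rplus/0]_x f x.
Proof. by move=> f0; elim/big_ind: _ => [|a b|i _] //; [exact: Rle_refl|exact: Rplus_le_le_0_compat]. Qed.

Lemma prodR_le (T : finType) (f g : T -> R) : (forall x, 0 <= f x <= g x) ->
  0 <= \big[Rmult/1]_x f x <= \big[Rmult/1]_x g x.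
Proof.
move=> fg; elim/big_ind2: _ => [|a b c d [a0 ab] [c0 cd]|i _]; last exact: fg; first lra.
by split; [exact: Rmult_le_pos|exact: Rmult_le_compat].
Qed.

Lemma prodR_exp (T : finType) (f : T -> R) :
  \big[Rmult/1]_x exp (f x) = exp (\big[Rplus/0]_x f x).
Proof. by rewrite (big_morph exp exp_plus exp_0). Qed.

Lemma sumR_const (T : finType) (a : R) : \big[Rplus/0]_(x : T) a = INR #|T| * a.
Proof.
rewrite big_const; elim: #|T| => [|n IH] /=; first by rewrite Rmult_0_l.
by rewrite IH -/(INR n.+1) S_INR; ring.
Qed.

Lemma sumR_mull (T : finType) a (f : T -> R) :
  a * \big[Rplus/0]_x f x = \big[Rplus/0]_x (a * f x).
Proof. exact: big_distrr. Qed.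

Lemma sumR_mulr (T : finType) a (f : T -> R) :
  (\big[Rplus/0]_x f x) * a = \big[Rplus/0]_x (f x * a).
Proof. exact: big_distrl. Qed.

Lemma sumR_opp (T : finType) (f : T -> R) :
  - (\big[Rplus/0]_x f x) = \big[Rplus/0]_x (- f x).
Proof. by rewrite (big_morph Ropp Ropp_plus_distr Ropp_0). Qed.

(** Independence in the form used for both product measures, over spins and over edges. *)
Lemma sum_prod_bool (I : finType) (F : I -> bool -> R) :
  \big[Rplus/0]_(f : {ffun I -> bool}) \big[Rmult/1]_i F i (f i) =
  \big[Rmult/1]_i (F i true + F i false).
Proof. by rewrite -bigA_distr_bigA; apply: eq_bigr => i _; rewrite big_bool. Qed.

(** * Sums over vertex pairs and the coupling quadratic form *)

Lemma sum_pair_t n (F : 'I_n * 'I_n -> R) :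
  \big[Rplus/0]_(e : pair_t n) F (val e) =
  \big[Rplus/0]_(e : 'I_n * 'I_n | ltn e.1 e.2) F e.
Proof. by rewrite -(big_sub (fun e : 'I_n * 'I_n => ltn e.1 e.2) F). Qed.

Lemma sum_sym_pair n (F : 'I_n -> 'I_n -> R) : (forall i j, F i j = F j i) ->
  \big[Rplus/0]_i \big[Rplus/0]_j F i j =
  \big[Rplus/0]_i F i i + 2 * \big[Rplus/0]_(e : pair_t n) F (val e).1 (val e).2.
Proof.
move=> symF; rewrite (sum_pair_t n (fun e => F e.1 e.2)) pair_bigA /=.
rewrite (bigID (fun e : 'I_n * 'I_n => e.1 == e.2)) /=; congr (_ + _).
  rewrite -(pair_big_dep predT (fun i j : 'I_n => i == j)) /=.
  by apply: eq_bigr => i _; rewrite (big_pred1 i).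
rewrite (bigID (fun e : 'I_n * 'I_n => ltn e.1 e.2)) /=.
rewrite (eq_bigl (fun e : 'I_n * 'I_n => ltn e.1 e.2)); last first.
  by move=> [i j] /=; rewrite -val_eqE /=; case: ltngtP.
rewrite [X in _ + X](eq_bigl (fun e : 'I_n * 'I_n => ltn e.2 e.1)); last first.
  by move=> [i j] /=; rewrite -val_eqE /=; case: ltngtP.
rewrite [X in _ + X](reindex (fun e : 'I_n * 'I_n => (e.2, e.1))) /=; last first.
  by exists (fun e => (e.2, e.1)) => -[].
rewrite (eq_bigr (fun e : 'I_n * 'I_n => F e.1 e.2) (fun e _ => symF _ _)).
ring.
Qed.

Lemma sum_prod_pair n (f : 'I_n -> R) :
  2 * \big[Rplus/0]_(e : pair_t n) (f (val e).1 * f (val e).2) =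
  (\big[Rplus/0]_i f i) ^ 2 - \big[Rplus/0]_i f i ^ 2.
Proof.
have := sum_sym_pair n (fun i j => f i * f j) (fun i j => Rmult_comm _ _).
rewrite (_ : \big[Rplus/0]_i \big[Rplus/0]_j (f i * f j) = (\big[Rplus/0]_i f i) ^ 2).
  rewrite (_ : \big[Rplus/0]_i (f i * f i) = \big[Rplus/0]_i f i ^ 2); first lra.
  by apply: eq_bigr => i _ /=; ring.
rewrite /= Rmult_1_r big_distrlr /=.
by apply: eq_bigr.
Qed.

(* Stated for an arbitrary index [c], so that [z] can be destructed although [f] depends on [b]. *)
Lemma alt_spec_true (A : Type) (b c : bool) (z : alt_spec b b c) (f : b -> A)
  (g : ~~ b -> A) (h : b) :
  match z with AltTrue k => f k | AltFalse k => g k end = f h.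
Proof.
case: z => k; first by rewrite (bool_irrelevance k h).
by case: (negP k).
Qed.

Lemma alt_spec_false (A : Type) (b c : bool) (z : alt_spec b b c) (f : b -> A)
  (g : ~~ b -> A) (h : ~~ b) :
  match z with AltTrue k => f k | AltFalse k => g k end = g h.
Proof.
case: z => k; last by rewrite (bool_irrelevance k h).
by case: (negP h).
Qed.

Lemma adj_lt n (G : graph n) (i j : 'I_n) (ij : ltn i j) :
  adj G i j = if G (exist _ (i, j) ij) then 1 else 0.
Proof.
rewrite /adj.
exact: (alt_spec_true _ _ _ _ (fun h : ltn i j => if G (exist _ (i, j) h) then 1 else 0)).
Qed.

Lemma adj_gt n (G : graph n) (i j : 'I_n) (ji : ltn j i) :
  adj G i j = if G (exist _ (j, i) ji) then 1 else 0.
Proof.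
have ij : ~~ ltn i j by rewrite /= -leqNgt ltnW.
rewrite /adj (alt_spec_false _ _ _ _ (fun h : ltn i j => if G (exist _ (i, j) h) then 1 else 0) _ ij).
exact: (alt_spec_true _ _ _ _ (fun h : ltn j i => if G (exist _ (j, i) h) then 1 else 0)).
Qed.

Lemma adj_diag n (G : graph n) i : adj G i i = 0.
Proof.
have ii : ~~ ltn i i by rewrite /= ltnn.
rewrite /adj (alt_spec_false _ _ _ _ (fun h : ltn i i => if G (exist _ (i, i) h) then 1 else 0) _ ii).
exact: (alt_spec_false _ _ _ _ (fun h : ltn i i => if G (exist _ (i, i) h) then 1 else 0)).
Qed.

Lemma adj_sym n (G : graph n) i j : adj G i j = adj G j i.
Proof.
case: (ltngtP i j) => [ij|ji|/val_inj -> //].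
  by rewrite (adj_lt _ _ _ _ ij) (adj_gt _ _ _ _ ij).
by rewrite (adj_lt _ _ _ _ ji) (adj_gt _ _ _ _ ji).
Qed.

Lemma adj_pair n (G : graph n) (e : pair_t n) :
  adj G (val e).1 (val e).2 = if G e then 1 else 0.
Proof. by case: e => -[i j] /= ij; exact: adj_lt. Qed.

Lemma coupling_form n p (G : graph n) (f : 'I_n -> R) :
  \big[Rplus/0]_i \big[Rplus/0]_j (f i * coupling p G i j * f j) =
  2 / ((INR n - 1) * p) *
    \big[Rplus/0]_(e : pair_t n) (if G e then f (val e).1 * f (val e).2 else 0).
Proof.
rewrite sum_sym_pair => [|i j]; last by rewrite /coupling adj_sym; ring.
rewrite big1 => [|i _]; last by rewrite /coupling adj_diag /Rdiv; ring.
rewrite Rplus_0_l /Rdiv Rmult_assoc; congr (_ * _); rewrite sumR_mull.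
apply: eq_bigr => e _; rewrite /coupling adj_pair /Rdiv; case: (G e); ring.
Qed.

(** * Averaging over the graph *)

Definition tilt (n : nat) (p t beta : R) (G : graph n) (x : config n) : R :=
  beta / ((INR n - 1) * p) *
    \big[Rplus/0]_(e : pair_t n)
      (if G e then spin (x (val e).1) * spin (x (val e).2) - t ^ 2 else 0)
  - beta * t * \big[Rplus/0]_i (spin (x i) - t).

(** The normaliser of the conditional density given [G]. It depends on the graph, and only its mean
    over [G] will be bounded. *)
Definition tilt_mean (n : nat) (p t beta : R) (G : graph n) : R :=
  \big[Rplus/0]_(x : config n) (Q_mass t x * exp (tilt n p t beta G x)).

Lemma Q_mass_gt0 n t (x : config n) : 0 < t < 1 -> 0 < Q_mass t x.
Proof.
move=> ht; rewrite /Q_mass; elim/big_ind: _ => [|a b|i _]; first lra.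
  exact: Rmult_lt_0_compat.
by case: (x i); lra.
Qed.

Lemma Q_mass_sum1 n t : \big[Rplus/0]_(x : config n) Q_mass t x = 1.
Proof.
rewrite (sum_prod_bool _ (fun _ b => if b then (1 + t) / 2 else (1 - t) / 2)).
by rewrite big1 // => i _; field.
Qed.

Lemma er_mass_ge0 n p (G : graph n) : 0 < p <= 1 -> 0 <= er_mass p G.
Proof.
move=> hp; rewrite /er_mass; elim/big_ind: _ => [|a b|i _]; first lra.
  exact: Rmult_le_pos.
by case: (G i); lra.
Qed.

Lemma er_mass_sum1 n p : \big[Rplus/0]_(G : graph n) er_mass p G = 1.
Proof.
rewrite (sum_prod_bool _ (fun _ b => if b then p else 1 - p)).
by rewrite big1 // => i _; ring.
Qed.

Lemma Q_mass_exp n h : exists2 K, 0 < K & forall x : config n,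
  exp (h * \big[Rplus/0]_i spin (x i)) = K * Q_mass (tanh h) x.
Proof.
have ch := cosh_gt0 h.
exists (\big[Rmult/1]_(i : 'I_n) (2 * cosh h)).
  by elim/big_ind: _ => [|a b|i _]; [lra|exact: Rmult_lt_0_compat|lra].
move=> x; rewrite sumR_mull -prodR_exp /Q_mass -big_split /=.
apply: eq_bigr => i _; rewrite /tanh; case: (x i) => /=.
  have -> : exp (h * 1) = cosh h + sinh h by rewrite /cosh /sinh Rmult_1_r; field.
  by field; lra.
have -> : exp (h * -1) = cosh h - sinh h.
  by rewrite /cosh /sinh (_ : h * -1 = - h); [field|ring].
by field; lra.
Qed.

(** The field is split as B = (beta t + B) - beta t. The first part produces [Q_mass t], the second
    the linear term of [tilt]. *)
Lemma ising_weight_tilt n p t beta B (G : graph n) : t = tanh (beta * t + B) ->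
  exists2 K, 0 < K & forall x : config n,
  ising_weight p beta B G x = K * (Q_mass t x * exp (tilt n p t beta G x)).
Proof.
move=> th; have [K K0 HK] := Q_mass_exp n (beta * t + B).
set g := \big[Rplus/0]_(e : pair_t n) (if G e then t ^ 2 else 0).
pose c := beta / ((INR n - 1) * p).
(* The extra factor undoes the centring of the edge products by t^2 and of the spins by t. It
   depends on [G] but not on [x], so it cancels against [ising_Z]. *)
exists (K * exp (c * g - beta * t * (INR n * t))).
  exact: Rmult_lt_0_compat (exp_pos _).
move=> x; have := HK x; rewrite -th => HKx.
rewrite /ising_weight /fsum (coupling_form _ _ _ (fun i => spin (x i))).
rewrite -[RHS](_ : K * Q_mass t x * (exp (c * g - beta * t * (INR n * t)) *
  exp (tilt n p t beta G x)) = _); last ring.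
rewrite -HKx -!exp_plus; congr exp; rewrite /tilt -/c.
have -> : \big[Rplus/0]_i (spin (x i) - t) = \big[Rplus/0]_i spin (x i) - INR n * t.
  by rewrite big_split /= -sumR_opp sumR_const card_ord.
have -> : \big[Rplus/0]_(e : pair_t n)
      (if G e then spin (x (val e).1) * spin (x (val e).2) else 0) =
   g + \big[Rplus/0]_(e : pair_t n)
      (if G e then spin (x (val e).1) * spin (x (val e).2) - t ^ 2 else 0).
  by rewrite /g -big_split /=; apply: eq_bigr => e _; case: (G e); ring.
by rewrite /c /Rdiv; set iN := / ((INR n - 1) * p); field.
Qed.

Lemma tilt_mean_gt0 n p t beta (G : graph n) : 0 < t < 1 -> 0 < tilt_mean n p t beta G.
Proof.
move=> ht; rewrite /tilt_mean (bigD1 [ffun=> true]) //=.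
apply: Rplus_lt_le_0_compat; first exact: Rmult_lt_0_compat (Q_mass_gt0 _ _ _ ht) (exp_pos _).
elim/big_ind: _ => [|a b|x _]; [lra|exact: Rplus_le_le_0_compat|].
exact/Rlt_le/Rmult_lt_0_compat/exp_pos/Q_mass_gt0.
Qed.

Lemma Per_mass_tilt n p t beta B (w : config n * graph n) :
  0 < t < 1 -> t = tanh (beta * t + B) ->
  Per_mass p beta B w =
  QG_mass p t w * (exp (tilt n p t beta w.2 w.1) / tilt_mean n p t beta w.2).
Proof.
move=> ht th; have [K K0 HK] := ising_weight_tilt n p t beta B w.2 th.
rewrite /Per_mass /QG_mass /ising_Z /fsum (eq_bigr _ (fun x _ => HK x)) HK -sumR_mull.
rewrite -/(tilt_mean n p t beta w.2).
by have M0 := tilt_mean_gt0 n p t beta w.2 ht; field; lra.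
Qed.

Lemma er_mgf_le n p (v : pair_t n -> R) : 0 < p <= 1 -> (forall e, v e <= 1 / 2) ->
  \big[Rplus/0]_(G : graph n)
     (er_mass p G * exp (\big[Rplus/0]_e (if G e then v e else 0)))
  <= exp (\big[Rplus/0]_e (p * v e + 2 * p * v e ^ 2)).
Proof.
move=> hp hv.
rewrite (eq_bigr (fun G : graph n => \big[Rmult/1]_e
    (if G e then p * exp (v e) else 1 - p))); last first.
  move=> G _; rewrite -prodR_exp /er_mass -big_split /=; apply: eq_bigr => e _.
  by case: (G e) => //; rewrite exp_0 Rmult_1_r.
rewrite (sum_prod_bool _ (fun e b => if b then p * exp (v e) else 1 - p)).
rewrite -prodR_exp; apply: (proj2 (prodR_le _ _ _ _)) => e; split.
  by have := Rmult_lt_0_compat _ _ (proj1 hp) (exp_pos (v e)); lra.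
by have := bernoulli_mgf_le p (v e) ltac:(lra) (hv e); lra.
Qed.

Lemma card_pair_t n : INR #|{: pair_t n}| <= INR n ^ 2.
Proof.
rewrite /= Rmult_1_r -mult_INR; apply: le_INR; apply/leP.
rewrite card_sig multE; have := max_card [pred e : 'I_n * 'I_n | ltn e.1 e.2].
by rewrite card_prod card_ord.
Qed.

(** Apply [sum_prod_pair] to the spins, whose squares are 1, and to the constant t; then write the
    magnetisation as S + n t. *)
Lemma sum_spin_pair n t (x : config n) :
  \big[Rplus/0]_(e : pair_t n) (spin (x (val e).1) * spin (x (val e).2) - t ^ 2) =
  ((\big[Rplus/0]_i (spin (x i) - t)) ^ 2
   + 2 * INR n * t * \big[Rplus/0]_i (spin (x i) - t) - INR n * (1 - t ^ 2)) / 2.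
Proof.
have := sum_prod_pair n (fun i => spin (x i)).
have := sum_prod_pair n (fun _ => t).
rewrite !big_split /= -!sumR_opp !sumR_const card_ord.
rewrite (eq_bigr (fun i : 'I_n => 1) (F1 := fun i => spin (x i) ^ 2)); last first.
  by move=> i _; case: (x i) => /=; ring.
rewrite sumR_const card_ord Rmult_1_r.
set a := \big[Rplus/0]_(i < n) spin (x i); set b := \big[_/_]_e _.
pose m := INR #|{: pair_t n}|.
rewrite -[_ + - _]/(b + - (m * (t * (t * 1)))).
by move=> e1 e2; have e1' : 2 * (m * (t * t)) = _ := e1; lra.
Qed.

(** Bounds the second-order terms of the edge average: at most n^2 <= 4 (n - 1)^2 pairs, each
    contributing at most 8 p c^2 with c = beta / ((n - 1) p). *)
Definition annealed_const (p beta : R) := 32 * beta ^ 2 / p.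

(* Only the centred quadratic form survives: the linear part of the edge average is
   [beta * t * S], which the last term of [tilt] subtracts. *)
Lemma annealed_tilt_le n p t beta s (x : config n) :
  0 < p <= 1 -> 0 < t < 1 -> 0 < beta -> s ^ 2 = 1 -> 2 <= INR n ->
  4 * beta <= (INR n - 1) * p ->
  \big[Rplus/0]_(G : graph n) (er_mass p G * exp (s * tilt n p t beta G x)) <=
  exp (s * (beta / (2 * (INR n - 1))) *
        ((\big[Rplus/0]_i (spin (x i) - t)) ^ 2
         + 2 * t * \big[Rplus/0]_i (spin (x i) - t) - INR n * (1 - t ^ 2))
       + annealed_const p beta).
Proof.
move=> hp ht hb hs n2 hn.
set S := \big[Rplus/0]_i (spin (x i) - t).
set c := beta / ((INR n - 1) * p).
have Np : 0 < (INR n - 1) * p by apply: Rmult_lt_0_compat; lra.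
have c0 : 0 <= c by apply/Rlt_le/Rdiv_lt_0_compat.
(* Since the edge terms satisfy |u| <= 2, this keeps the exponents s c u below the 1/2 required by
   [er_mgf_le]. *)
have c4 : c <= 1 / 4 by apply/Rle_div_l => //; lra.
pose u (e : pair_t n) := spin (x (val e).1) * spin (x (val e).2) - t ^ 2.
have hu e : -2 <= u e <= 2.
  by rewrite /u; case: (x _); case: (x _) => /=; nra.
have hs1 : s = 1 \/ s = -1.
  have : (s - 1) * (s + 1) = 0 by lra.
  by move=> /Rmult_integral [|] ?; [left|right]; lra.
rewrite (eq_bigr (fun G : graph n => er_mass p G *
   exp (\big[Rplus/0]_e (if G e then s * c * u e else 0)) *
   exp (- s * (beta * t * S)))); last first.
  move=> G _; rewrite Rmult_assoc -exp_plus /tilt -/c -/S; congr (_ * exp _).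
  have -> : \big[Rplus/0]_e (if G e then s * c * u e else 0) =
      s * c * \big[Rplus/0]_e (if G e then u e else 0).
    by rewrite sumR_mull; apply: eq_bigr => e _; case: (G e); ring.
  set X := \big[Rplus/0]_e (if G e then u e else 0).
  by rewrite -[LHS]/(s * (c * X - beta * t * S)); ring.
rewrite -sumR_mulr.
apply: Rle_trans.
  apply: Rmult_le_compat_r; first exact/Rlt_le/exp_pos.
  apply: er_mgf_le => // e.
  have := hu e; case: hs1 => ->; nra.
rewrite -exp_plus; apply: exp_le.
rewrite big_split /=.
have -> : \big[Rplus/0]_e (p * (s * c * u e)) = p * s * c * ((S ^ 2
   + 2 * INR n * t * S - INR n * (1 - t ^ 2)) / 2).
  by rewrite -sum_spin_pair sumR_mull; apply: eq_bigr => e _; rewrite /u; ring.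
have quad : \big[Rplus/0]_e (2 * p * (s * c * u e) ^ 2) <= annealed_const p beta.
  apply: (Rle_trans _ (\big[Rplus/0]_(e : pair_t n) (8 * p * c ^ 2))).
    apply: sumR_le => e.
    have u4 : u e ^ 2 <= 4 by have := hu e; nra.
    rewrite (_ : 2 * p * (s * c * u e) ^ 2 = 2 * p * c ^ 2 * u e ^ 2 * s ^ 2); last ring.
    have k0 : 0 <= 2 * p * c ^ 2 by apply: Rmult_le_pos; [lra|exact: pow2_ge_0].
    by have := Rmult_le_compat_l _ _ _ k0 u4; rewrite hs; lra.
  rewrite sumR_const.
  have n4 : INR #|{: pair_t n}| <= 4 * (INR n - 1) ^ 2.
    by apply: Rle_trans (card_pair_t n) _; nra.
  have k0 : 0 <= 8 * p * c ^ 2 by apply: Rmult_le_pos; [lra|exact: pow2_ge_0].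
  apply: Rle_trans (Rmult_le_compat_r _ _ _ k0 n4) _.
  by apply: Req_le; rewrite /annealed_const /c; field; lra.
(* Here p c = beta / (n - 1). Writing n = (n - 1) + 1 in 2 n t S isolates the term s beta t S to be
   cancelled and leaves 2 t S. *)
have -> : p * s * c * ((S ^ 2 + 2 * INR n * t * S - INR n * (1 - t ^ 2)) / 2) =
  s * (beta / (2 * (INR n - 1))) * (S ^ 2 + 2 * t * S - INR n * (1 - t ^ 2))
  + s * (beta * t * S).
  by rewrite /c; field; lra.
by move: quad; set q := \big[Rplus/0]_e (2 * _ * _); lra.
Qed.

(** * Square-exponential moments of sub-Gaussian sums *)

Lemma exp_pow a k : exp a ^ k = exp (INR k * a).
Proof.
elim: k => [|k IH]; first by rewrite Rmult_0_l exp_0.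
by rewrite S_INR Rmult_plus_distr_r Rmult_1_l exp_plus -IH /=; ring.
Qed.

Lemma geometric_sum_le K r : 0 <= r < 1 -> \big[Rplus/0]_(k < K) r ^ k <= / (1 - r).
Proof.
move=> hr; apply: (Rmult_le_reg_r (1 - r)); first lra.
rewrite Rinv_l; last lra.
suff -> : (\big[Rplus/0]_(k < K) r ^ k) * (1 - r) = 1 - r ^ K.
  by have := pow_le r K (proj1 hr); lra.
elim: K => [|K IH]; first by rewrite big_ord0 /=; ring.
by rewrite big_ord_recr /= Rmult_plus_distr_r IH; ring.
Qed.

Lemma nat_near y K : 0 <= y <= INR K -> exists k : 'I_K.+1, (y - INR k) ^ 2 <= 1.
Proof.
elim: K => [|K IH] hy; first by exists ord0; move: hy => /=; nra.
case: (Rle_dec y (INR K)) => hK.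
  have [k hk] := IH (conj (proj1 hy) hK).
  by exists (widen_ord (leqnSn _) k).
have eK : INR (@ord_max K.+1) = INR K + 1 by rewrite -S_INR.
by exists ord_max; rewrite eK; move: hy; rewrite S_INR; nra.
Qed.

(* A discrete Hubbard-Stratonovich transform: [exp (y^2/2)] is bounded by a mixture of
   exponentials of integer multiples of [y]. *)
Lemma exp_half_sqr_le K y : Rabs y <= INR K ->
  exp (y ^ 2 / 2) <= exp (1 / 2) * \big[Rplus/0]_(k < K.+1)
     (exp (- INR k ^ 2 / 2) * (exp (INR k * y) + exp (- INR k * y))).
Proof.
move=> hK; have [k hk] := nat_near (Rabs y) K (conj (Rabs_pos y) hK).
rewrite (bigD1 k) //=; set rest := \big[_/_]_(_ | _) _.
have rest0 : 0 <= rest.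
  rewrite /rest; elim/big_ind: _ => [|a b|i _]; [lra|exact: Rplus_le_le_0_compat|].
  by apply: Rmult_le_pos; [|apply: Rplus_le_le_0_compat]; exact/Rlt_le/exp_pos.
(* Completing the square: y^2/2 = k|y| - k^2/2 + (|y| - k)^2/2, and the last term is at most 1/2. *)
have le1 : exp (y ^ 2 / 2) <= exp (1 / 2) * (exp (- INR k ^ 2 / 2) * exp (INR k * Rabs y)).
  by rewrite -!exp_plus; apply: exp_le; rewrite -(pow2_abs y); lra.
have le2 : exp (INR k * Rabs y) <= exp (INR k * y) + exp (- INR k * y).
  have := exp_pos (INR k * y); have := exp_pos (- INR k * y).
  rewrite /Rabs; case: Rcase_abs => _; last lra.
  by rewrite -Ropp_mult_distr_r Ropp_mult_distr_l; lra.
apply: Rle_trans le1 _; apply: Rmult_le_compat_l; first exact/Rlt_le/exp_pos.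
have := Rmult_le_compat_l _ _ _ (Rlt_le _ _ (exp_pos (- INR k ^ 2 / 2))) le2.
by rewrite [INR k ^ 2]/=; lra.
Qed.

(** Apply [exp_half_sqr_le] to sqrt(l) S and average. The index k contributes at most 2 exp(-(1 - q)
    k^2 / 2), which is summable because q < 1. *)
Lemma subgaussian_exp_sqr_le (T : finType) (m S : T -> R) (v l q : R) :
  (forall x, 0 <= m x) -> 0 <= l -> l * v <= q -> q < 1 ->
  (forall z, \big[Rplus/0]_x (m x * exp (z * S x)) <= exp (v * z ^ 2 / 2)) ->
  \big[Rplus/0]_x (m x * exp (l * S x ^ 2 / 2)) <=
  2 * exp (1 / 2) / (1 - exp (- (1 - q) / 2)).
Proof.
move=> m0 l0 lv q1 mgf; set r := sqrt l; have rl : r * r = l by exact: sqrt_sqrt.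
(* The cutoff [K] exists because [T] is finite; the geometric series makes the final bound
   independent of it. *)
have [K hK] : exists K, forall x, Rabs (r * S x) <= INR K.
  have [K hK] := INR_unbounded (\big[Rplus/0]_x Rabs (r * S x)).
  exists K => x; apply: Rle_trans (Rlt_le _ _ hK); rewrite (bigD1 x) //=.
  rewrite -{1}(Rplus_0_r (Rabs _)); apply: Rplus_le_compat_l.
  elim/big_ind: _ => [|a b|i _]; [lra|exact: Rplus_le_le_0_compat|exact: Rabs_pos].
pose E k := exp (- INR k ^ 2 / 2).
apply: (Rle_trans _ (\big[Rplus/0]_x (exp (1 / 2) * \big[Rplus/0]_(k < K.+1)
   (E k * (m x * exp (INR k * r * S x) + m x * exp (- INR k * r * S x)))))).
  apply: sumR_le => x; have := exp_half_sqr_le K _ (hK x).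
  rewrite (_ : (r * S x) ^ 2 / 2 = l * S x ^ 2 / 2); last by rewrite -rl; field.
  move=> /(Rmult_le_compat_l _ _ _ (m0 x)) h; apply: Rle_trans h _; apply: Req_le.
  rewrite -Rmult_assoc (Rmult_comm (m x)) Rmult_assoc sumR_mull; congr (_ * _).
  by apply: eq_bigr => k _; rewrite /E !Rmult_assoc; ring.
rewrite -sumR_mull exchange_big /=.
have rho : 0 < exp (- (1 - q) / 2) < 1.
  by split; [exact: exp_pos|rewrite -[X in _ < X]exp_0; apply: exp_increasing; lra].
apply: (Rle_trans _ (exp (1 / 2) *
    \big[Rplus/0]_(k < K.+1) (2 * exp (- (1 - q) / 2) ^ k))); last first.
  rewrite -sumR_mull.
  have geo := geometric_sum_le K.+1 (exp (- (1 - q) / 2)) ltac:(lra).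
  have e0 : 0 <= exp (1 / 2) * 2 by have := exp_pos (1 / 2); lra.
  rewrite -Rmult_assoc; apply: Rle_trans (Rmult_le_compat_l _ _ _ e0 geo) _.
  by apply: Req_le; field; lra.
apply: Rmult_le_compat_l; first exact/Rlt_le/exp_pos.
apply: sumR_le => k; rewrite -sumR_mull big_split /=.
have := mgf (INR k * r); have := mgf (- INR k * r) => h1 h2.
(* For integers k <= k^2, so the Gaussian decay is dominated by a geometric one. *)
have k2 : INR k <= INR k ^ 2.
  case: k {h1 h2} => -[|k] _ /=; first lra.
  by rewrite -/(INR k.+1) S_INR; have := pos_INR k; nra.
have Ek : E k * exp (v * (INR k * r) ^ 2 / 2) <= exp (- (1 - q) / 2) ^ k.
  rewrite exp_pow /E -exp_plus; apply: exp_le.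
  rewrite (_ : (INR k * r) ^ 2 = INR k ^ 2 * l); last by rewrite -rl; ring.
  by nra.
have E0 : 0 <= E k by exact/Rlt_le/exp_pos.
apply: (Rle_trans _ (E k * (2 * exp (v * (INR k * r) ^ 2 / 2)))); last lra.
apply: Rmult_le_compat_l => //.
by move: h1; rewrite (_ : (- INR k * r) ^ 2 = (INR k * r) ^ 2); [lra|ring].
Qed.

Lemma Q_mgf_le n h z : 0 < h -> 0 < tanh h < 1 ->
  \big[Rplus/0]_(x : config n)
     (Q_mass (tanh h) x * exp (z * \big[Rplus/0]_i (spin (x i) - tanh h)))
  <= exp (INR n * (tanh h / h) * z ^ 2 / 2).
Proof.
move=> h0; set t := tanh h => ht.
rewrite (eq_bigr (fun x : config n => \big[Rmult/1]_i (if x i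
   then (1 + t) / 2 * exp (z * (1 - t)) else (1 - t) / 2 * exp (z * (-1 - t))))); last first.
  move=> x _; rewrite sumR_mull -prodR_exp /Q_mass -big_split /=.
  by apply: eq_bigr => i _; case: (x i).
rewrite (sum_prod_bool _ (fun _ b => if b
   then (1 + t) / 2 * exp (z * (1 - t)) else (1 - t) / 2 * exp (z * (-1 - t)))).
have -> : INR n * (t / h) * z ^ 2 / 2 = \big[Rplus/0]_(i < n) (t / h * z ^ 2 / 2).
  by rewrite sumR_const card_ord; field; lra.
rewrite -prodR_exp; apply: (proj2 (prodR_le _ _ _ _)) => i; split; last first.
  exact: two_point_mgf_le.
by apply: Rplus_le_le_0_compat; apply: Rmult_le_pos; try exact/Rlt_le/exp_pos; lra.
Qed.

(** * Contiguity *)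

Lemma QG_mass_ge0 n p t (w : config n * graph n) : 0 < p <= 1 -> 0 < t < 1 ->
  0 <= QG_mass p t w.
Proof.
move=> hp ht; apply: Rmult_le_pos (er_mass_ge0 _ _ _ hp).
exact/Rlt_le/Q_mass_gt0.
Qed.

Lemma QG_mass_sum1 n p t : \big[Rplus/0]_(w : config n * graph n) QG_mass p t w = 1.
Proof.
rewrite -(pair_bigA _ (fun x G => Q_mass t x * er_mass p G)) /=.
rewrite -[RHS](Q_mass_sum1 n t); apply: eq_bigr => x _.
by rewrite -sumR_mull er_mass_sum1 Rmult_1_r.
Qed.

Lemma QG_tilt_le n p t beta s (D : config n -> R) : 0 < t < 1 ->
  (forall x, \big[Rplus/0]_(G : graph n) (er_mass p G * exp (s * tilt n p t beta G x)) <= D x) ->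
  \big[Rplus/0]_(w : config n * graph n) (QG_mass p t w * exp (s * tilt n p t beta w.2 w.1))
  <= \big[Rplus/0]_x (Q_mass t x * D x).
Proof.
move=> ht hD.
rewrite -(pair_bigA _ (fun x G => Q_mass t x * er_mass p G * exp (s * tilt n p t beta G x))) /=.
apply: sumR_le => x; rewrite (eq_bigr _ (fun G _ => Rmult_assoc _ _ _)) -sumR_mull.
by apply: Rmult_le_compat_l (hD x); exact/Rlt_le/Q_mass_gt0.
Qed.

(** Fubini, with [Q_mass] of total mass 1. The factor 1 in the exponent matches the sign [s] of
    [QG_tilt_le]. *)
Lemma QG_tilt_mean n p t beta :
  \big[Rplus/0]_(w : config n * graph n) (QG_mass p t w * tilt_mean n p t beta w.2) =
  \big[Rplus/0]_(w : config n * graph n) (QG_mass p t w * exp (1 * tilt n p t beta w.2 w.1)).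
Proof.
rewrite -(pair_bigA _ (fun x G => Q_mass t x * er_mass p G * tilt_mean n p t beta G)).
rewrite -(pair_bigA _ (fun x G => Q_mass t x * er_mass p G * exp (1 * tilt n p t beta G x))) /=.
rewrite exchange_big [RHS]exchange_big /=; apply: eq_bigr => G _.
rewrite (eq_bigr _ (fun x _ => Rmult_assoc _ _ _)) -sumR_mulr Q_mass_sum1 Rmult_1_l.
rewrite /tilt_mean sumR_mull; apply: eq_bigr => x _; rewrite Rmult_1_l; ring.
Qed.

Lemma tilt_moments_bounded p t beta B :
  0 < p <= 1 -> 0 < t < 1 -> Theta_t t beta B ->
  exists C, 0 < C /\ exists n0 : nat, forall n, INR n0 <= INR n ->
   \big[Rplus/0]_(w : config n * graph n) (QG_mass p t w * exp (- tilt n p t beta w.2 w.1)) <= C /\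
   \big[Rplus/0]_(w : config n * graph n) (QG_mass p t w * tilt_mean n p t beta w.2) <= C.
Proof.
move=> hp ht [hb [hB th]]; set h := beta * t + B in th.
have h0 : 0 < h by rewrite /h; nra.
set b := beta * (t / h).
(* b = beta t / (beta t + B) is below 1 because B > 0. *)
have b1 : 0 < b < 1.
  rewrite /b; split; first by apply: Rmult_lt_0_compat => //; apply: Rdiv_lt_0_compat; lra.
  rewrite (_ : beta * (t / h) = beta * t / h); last by field; lra.
  by apply/Rlt_div_l => //; rewrite /h; lra.
set A := annealed_const p beta.
(* The midpoint of b and 1 leaves room for the factor n / (n - 1): the relevant product is b n / (n
   - 1), at most q for large n. *)
set q := (1 + b) / 2; set g := 2 * exp (1 / 2) / (1 - exp (- (1 - q) / 2)).
have g0 : 0 < g.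
  apply: Rdiv_lt_0_compat; first by have := exp_pos (1 / 2); lra.
  suff : exp (- (1 - q) / 2) < exp 0 by rewrite exp_0; lra.
  by apply: exp_increasing; rewrite /q; lra.
(* The three summands yield [n2], [nb] and [nq] respectively. *)
have [n0 hn0] := INR_unbounded (2 + 4 * beta / p + 2 / (1 - b)).
exists (exp (beta + A) + exp (2 * beta + A) * g); split.
  by apply: Rplus_lt_0_compat; [|apply: Rmult_lt_0_compat => //]; exact: exp_pos.
exists n0 => n n0n.
have bp : 0 < 4 * beta / p by apply: Rdiv_lt_0_compat; lra.
have bb : 0 < 2 / (1 - b) by apply: Rdiv_lt_0_compat; lra.
have n2 : 2 <= INR n by lra.
have nb : 4 * beta <= (INR n - 1) * p by apply/Rle_div_l; lra.
have nq : 2 <= (1 - b) * (INR n - 1).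
  by rewrite Rmult_comm; apply/Rle_div_l; lra.
set N := INR n - 1 in nb nq; have N0 : 0 < N by rewrite /N; lra.
set k := beta / (2 * N).
have k0 : 0 < k by apply: Rdiv_lt_0_compat; lra.
have kn : k * INR n <= beta.
  by rewrite (_ : beta = k * (2 * N)); [apply: Rmult_le_compat_l; rewrite /N; lra|rewrite /k; field; lra].
have C1 : 0 < exp (beta + A) by exact: exp_pos.
have C2 : 0 < exp (2 * beta + A) * g by apply: Rmult_lt_0_compat => //; exact: exp_pos.
split.
  rewrite (eq_bigr (fun w : config n * graph n =>
    QG_mass p t w * exp (-1 * tilt n p t beta w.2 w.1))); last first.
    by move=> w _; congr (_ * exp _); ring.
  apply: (Rle_trans _ (\big[Rplus/0]_(x : config n) (Q_mass t x * exp (beta + A)))); last first.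
    by rewrite -sumR_mulr Q_mass_sum1; lra.
  apply: QG_tilt_le => // x.
  apply: Rle_trans (annealed_tilt_le n p t beta (-1) x hp ht hb ltac:(lra) n2 nb) _.
  apply: exp_le; rewrite -/A -/N -/k; set S := \big[_/_]_i _.
  suff : k * (- (S ^ 2 + 2 * t * S - INR n * (1 - t ^ 2))) <= k * INR n by lra.
  apply: Rmult_le_compat_l; first lra.
  (* Complete the square: -(S^2 + 2 t S) = t^2 - (S + t)^2, and t^2 <= n t^2. *)
  have := pow2_ge_0 (S + t); have := Rmult_le_compat_r (t ^ 2) _ _ (pow2_ge_0 t) n2; nra.
rewrite QG_tilt_mean.
apply: (Rle_trans _ (\big[Rplus/0]_(x : config n) (Q_mass t x *
  (exp (2 * beta + A) * exp (beta / N * (\big[Rplus/0]_i (spin (x i) - t)) ^ 2 / 2))))).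
  apply: QG_tilt_le => // x.
  apply: Rle_trans (annealed_tilt_le n p t beta 1 x hp ht hb ltac:(lra) n2 nb) _.
  rewrite -exp_plus; apply: exp_le; rewrite -/A -/N -/k; set S := \big[_/_]_i _.
  have Sn : S <= INR n.
    rewrite -[INR n]Rmult_1_r -[X in INR X](card_ord n) -sumR_const; apply: sumR_le => i.
    by case: (x i) => /=; lra.
  have -> : beta / N * S ^ 2 / 2 = k * S ^ 2 by rewrite /k; field; lra.
  (* The quadratic term is kept for the sub-Gaussian bound; the linear one costs at most 2 k n <= 2
     beta, as S <= n and t < 1. *)
  suff : k * (2 * t * S - INR n * (1 - t ^ 2)) <= k * (2 * INR n) by lra.
  apply: Rmult_le_compat_l; first lra.
  have : 0 <= INR n * (1 - t ^ 2) by apply: Rmult_le_pos; nra.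
  have := Rmult_le_compat_l t _ _ ltac:(lra) Sn; nra.
rewrite (eq_bigr (fun x : config n => exp (2 * beta + A) * (Q_mass t x *
  exp (beta / N * (\big[Rplus/0]_i (spin (x i) - t)) ^ 2 / 2)))); last by move=> x _; ring.
rewrite -sumR_mull.
suff le : \big[Rplus/0]_(x : config n) (Q_mass t x *
  exp (beta / N * (\big[Rplus/0]_i (spin (x i) - t)) ^ 2 / 2)) <= g.
  by apply: Rle_trans (Rmult_le_compat_l _ _ _ (Rlt_le _ _ (exp_pos _)) le) _; lra.
apply: (subgaussian_exp_sqr_le _ _ _ (INR n * (t / h))) => [x||||z].
- exact/Rlt_le/Q_mass_gt0.
- exact/Rlt_le/Rdiv_lt_0_compat.
- rewrite (_ : beta / N * (INR n * (t / h)) = b * INR n / N); last by rewrite /b; field; lra.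
  by apply/Rle_div_l => //; rewrite /q; rewrite /N in nq *; nra.
- by rewrite /q; lra.
- by rewrite th; apply: Q_mgf_le => //; rewrite -th.
Qed.

(** Where exp(-L) <= K and the normaliser is at most K, the density is at least 1/K^2. Each of the
    two exceptional sets has mass at most C/K by Markov's inequality. *)
Lemma prob_QG_le n p t beta B K C (E : config n * graph n -> Prop) :
  0 < p <= 1 -> 0 < t < 1 -> Theta_t t beta B -> 0 < K ->
  \big[Rplus/0]_(w : config n * graph n) (QG_mass p t w * exp (- tilt n p t beta w.2 w.1)) <= C ->
  \big[Rplus/0]_(w : config n * graph n) (QG_mass p t w * tilt_mean n p t beta w.2) <= C ->
  prob (@QG_mass n p t) E <= K ^ 2 * prob (@Per_mass n p beta B) E + 2 * C / K.
Proof.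
move=> hp ht [_ [_ th]] K0 hC1 hC2.
set T1 := \big[_/_]_w _ in hC1; set T2 := \big[_/_]_w _ in hC2.
apply: (Rle_trans _ (K ^ 2 * prob (@Per_mass n p beta B) E + (/ K * T1 + / K * T2))); last first.
  have iK : 0 <= / K by exact/Rlt_le/Rinv_0_lt_compat.
  have := Rmult_le_compat_l _ _ _ iK hC1; have := Rmult_le_compat_l _ _ _ iK hC2.
  by rewrite /Rdiv; lra.
rewrite /prob /fsum /T1 /T2 !sumR_mull -!big_split /=; apply: sumR_le => w.
set mu := QG_mass p t w; set L := tilt n p t beta w.2 w.1.
set M := tilt_mean n p t beta w.2.
have mu0 : 0 <= mu by exact: QG_mass_ge0.
have M0 : 0 < M by exact: tilt_mean_gt0.
have eL : exp L * exp (- L) = 1 by rewrite -exp_plus Rplus_opp_r exp_0.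
have L1 := exp_pos L; have L2 := exp_pos (- L).
have K1 : 0 < / K by exact: Rinv_0_lt_compat.
have r1 : 0 <= / K * (mu * exp (- L)).
  by apply: Rmult_le_pos; [lra|apply: Rmult_le_pos; lra].
have r2 : 0 <= / K * (mu * M) by apply: Rmult_le_pos; [lra|apply: Rmult_le_pos; lra].
case: excluded_middle_informative => Ew /=; last lra.
rewrite (Per_mass_tilt _ _ _ _ _ _ ht th) -/mu -/L -/M.
have r3 : 0 <= K ^ 2 * (mu * (exp L / M)).
  apply: Rmult_le_pos; first exact: pow2_ge_0.
  by apply: Rmult_le_pos => //; apply/Rlt_le/Rdiv_lt_0_compat.
(* Markov's inequality in pointwise form, used with a = exp(-L) and with a the normaliser. *)
have big a : K < a -> mu <= / K * (mu * a).
  move=> Ka; rewrite (_ : / K * (mu * a) = mu * (a / K)); last by field; lra.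
  rewrite -{1}(Rmult_1_r mu); apply: Rmult_le_compat_l => //.
  by apply/Rle_div_r => //; lra.
case: (Rlt_dec K (exp (- L))) => [/big|/Rnot_lt_le hL]; first lra.
case: (Rlt_dec K M) => [/big|/Rnot_lt_le hM]; first lra.
suff : mu <= K ^ 2 * (mu * (exp L / M)) by lra.
rewrite (_ : K ^ 2 * (mu * (exp L / M)) = mu * ((K * exp L) * (K / M))); last by field; lra.
rewrite -{1}(Rmult_1_r mu); apply: Rmult_le_compat_l => //.
have a1 : 1 <= K * exp L by rewrite -eL Rmult_comm; apply: Rmult_le_compat_r => //; lra.
have a2 : 1 <= K / M by apply/Rle_div_r => //; lra.
nra.
Qed.

Lemma contiguous p t beta B : 0 < p <= 1 -> 0 < t < 1 -> Theta_t t beta B ->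
  forall E : forall n : nat, config n * graph n -> Prop,
  Un_cv (fun n => prob (@Per_mass n p beta B) (E n)) 0 ->
  Un_cv (fun n => prob (@QG_mass n p t) (E n)) 0.
Proof.
move=> hp ht hT E hE eps eps0.
have [C [C0 [n0 hn0]]] := tilt_moments_bounded p t beta B hp ht hT.
(* Chosen so that 2C/K = eps/2; the other half of eps comes from the hypothesis on [E]. *)
set K := 4 * C / eps.
have K0 : 0 < K by apply: Rdiv_lt_0_compat; lra.
have K2 : 0 < K ^ 2 by exact: pow_lt.
have e2 : 0 < eps / 2 by lra.
have [n1 hn1] := hE (eps / 2 / K ^ 2) (Rdiv_lt_0_compat _ _ e2 K2).
exists (maxn n0 n1) => n /leP; rewrite geq_max => /andP[/leP /le_INR /hn0 [h1 h2]] /leP /hn1.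
have := prob_QG_le n p t beta B K C (E n) hp ht hT K0 h1 h2.
have q0 : 0 <= prob (@QG_mass n p t) (E n).
  apply: sumR_ge0 => w; case: excluded_middle_informative => ?; last exact: Rle_refl.
  exact: QG_mass_ge0.
rewrite /R_dist !Rminus_0_r (Rabs_pos_eq _ q0) => le.
set P := prob (@Per_mass n p beta B) (E n) in le * => hP.
have := Rmult_lt_compat_l _ _ _ K2 (Rle_lt_trans _ _ _ (Rle_abs P) hP).
rewrite (_ : K ^ 2 * (eps / 2 / K ^ 2) = eps / 2); last by field; lra.
suff : 2 * C / K = eps / 2 by lra.
by rewrite /K; field; lra.
Qed.

(** * Nonexistence of consistent estimators *)

Lemma Theta_t_two_points t : 0 < t < 1 ->
  exists b1 B1 b2 B2, [/\ Theta_t t b1 B1, Theta_t t b2 B2 & b1 <> b2].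
Proof.
(* [h] is artanh(t), so [Theta_t] is the open segment beta t + B = h in the positive quadrant. The
   witnesses below have beta t equal to h/2 and h/4. *)
move=> ht; set h := ln ((1 + t) / (1 - t)) / 2.
have r1 : 1 < (1 + t) / (1 - t) by apply/Rlt_div_r; lra.
have h0 : 0 < h.
  by have := ln_increasing 1 _ ltac:(lra) r1; rewrite ln_1 /h; lra.
have th : t = tanh h.
  have e1 : exp h * exp h = (1 + t) / (1 - t).
    by rewrite -exp_plus (_ : h + h = ln ((1 + t) / (1 - t))) ?exp_ln; rewrite /h; lra.
  have e0 := exp_pos h; rewrite /tanh /sinh /cosh exp_Ropp.
  have -> : (exp h - / exp h) / 2 / ((exp h + / exp h) / 2) =
      (exp h * exp h - 1) / (exp h * exp h + 1).
    by field; split; nra.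
  by rewrite e1; field; split; lra.
exists (h / 2 / t), (h / 2), (h / 4 / t), (3 * h / 4); split.
- split; first by apply: Rdiv_lt_0_compat; lra.
  by split; [lra|rewrite {1}th; congr tanh; field; lra].
- split; first by apply: Rdiv_lt_0_compat; lra.
  by split; [lra|rewrite {1}th; congr tanh; field; lra].
- move=> /(f_equal (fun x => x * t)).
  rewrite (_ : h / 2 / t * t = h / 2); last by field; lra.
  by rewrite (_ : h / 4 / t * t = h / 4); [lra|field; lra].
Qed.

Lemma no_consistent_estimator p t : 0 < p <= 1 -> 0 < t < 1 ->
  ~ (exists est : estimator,
      forall beta B : R, Theta_t t beta B -> consistent_at p est beta B).
Proof.
move=> hp ht [est hest].
have [b1 [B1 [b2 [B2 [T1 T2 b12]]]]] := Theta_t_two_points t ht.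
(* With a third of the distance, no estimate is within eps of both [b1] and [b2]. *)
set eps := Rabs (b1 - b2) / 3.
have eps0 : 0 < eps by have := Rabs_pos_lt (b1 - b2) ltac:(lra); rewrite /eps; lra.
have [n1 c1] := contiguous p t b1 B1 hp ht T1 _ (hest _ _ T1 eps eps0) (1 / 2) ltac:(lra).
have [n2 c2] := contiguous p t b2 B2 hp ht T2 _ (hest _ _ T2 eps eps0) (1 / 2) ltac:(lra).
have := c1 (maxn n1 n2) ltac:(by apply/leP; rewrite leq_maxl).
have := c2 (maxn n1 n2) ltac:(by apply/leP; rewrite leq_maxr).
set n := maxn n1 n2; rewrite /R_dist !Rminus_0_r.
set P2 := prob _ _; set P1 := prob _ _ => /Rabs_def2[h2 _] /Rabs_def2[h1 _].
(* The two error events cover the whole space, yet by contiguity each eventually has probability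
   below 1/2 under the common measure. *)
suff : 1 <= P1 + P2 by lra.
rewrite -(QG_mass_sum1 n p t) /P1 /P2 /prob /fsum -big_split /=; apply: sumR_le => w.
have mu0 := QG_mass_ge0 n p t w hp ht.
case: excluded_middle_informative => e1; case: excluded_middle_informative => e2 /=; try lra.
exfalso.
have l1 : Rabs (fst (est n w) - b1) <= eps by apply: Rnot_lt_le => ?; apply: e1; left.
have l2 : Rabs (fst (est n w) - b2) <= eps by apply: Rnot_lt_le => ?; apply: e2; left.
have := Rabs_triang (fst (est n w) - b2) (- (fst (est n w) - b1)).
rewrite Rabs_Ropp (_ : fst (est n w) - b2 + - (fst (est n w) - b1) = b1 - b2); last ring.
by rewrite /eps in eps0 l1 l2; lra.
Qed.

Theorem theorem4 (p t : R) (hp : 0 < p <= 1) (ht : 0 < t < 1) :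
  (forall beta B : R, Theta_t t beta B ->
     forall E : forall n : nat, config n * graph n -> Prop,
       Un_cv (fun n => prob (@Per_mass n p beta B) (E n)) 0 ->
       Un_cv (fun n => prob (@QG_mass n p t) (E n)) 0)
  /\ ~ (exists est : estimator,
          forall beta B : R, Theta_t t beta B -> consistent_at p est beta B)
  /\ ~ (exists est : estimator,
          forall beta B : R, 0 < beta -> B <> 0 -> consistent_at p est beta B).
Proof.
split; first by move=> beta B hT; exact: contiguous.
split; first exact: no_consistent_estimator.
move=> [est hest]; apply: (no_consistent_estimator p t hp ht).
by exists est => beta B [hb [hB _]]; apply: hest => //; lra.
Qed.
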